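(* Let $M=\mathbb R^7$ with coordinates $(x,z)=(x_1,x_2,x_3,x_4,z_1,z_2,z_3)$, with horizontal distribution $S=\mathrm{span}\{X_1,X_2,X_3,X_4\}$, the metric $Q$ of index $2$ on $S$, and the Hamiltonian $H$ as given in the context. The normal extremals $(x(t),z(t))$ starting from the identity $(0,0)$ of the group are given, through the solution of the Hamiltonian system of $H$, by the parametric equations \begin{align*} x_1(t)&=i|k|(c_1e^{at}+c_2e^{-at}+c_3e^{\bar a t}+c_4e^{-\bar a t})-i|k|(c_1+c_2+c_3+c_4),\\ x_2(t)&=|k|(c_1e^{at}-c_2e^{-at}-c_3e^{\bar a t}+c_4e^{-\bar a t})-|k|(c_1-c_2-c_3+c_4),\\ x_3(t)&=c_1ke^{at}+c_2\bar k e^{-at}-c_3\bar k e^{\bar a t}-c_4ke^{-\bar a t}-(c_1k+c_2\bar k-c_3\bar k-c_4k),\\ x_4(t)&=i(c_1ke^{at}-c_2\bar k e^{-at}+c_3\bar k e^{\bar a t}-c_4ke^{-\bar a t})-i(c_1k-c_2\bar k+c_3\bar k-c_4k), \end{align*} and \begin{align*} z_1(t)&=2i|k|^2\big(-2(c_1c_2a-c_3c_4\bar a)t+c_1c_2(e^{at}-e^{-at})-c_3c_4(e^{\bar a t}-e^{-\bar a t})\big),\\ z_2(t)&=2\theta_2|k|\big(-2(c_1c_2a+c_3c_4\bar a)t+c_1c_2(e^{at}-e^{-at})+c_3c_4(e^{\bar a t}-e^{-\bar a t})\big)\\ &\quad+2\theta_1\theta_3\big(c_1c_3e^{2|k|t}+c_2c_4e^{-2|k|t}-c_1c_3-c_2c_4\big)\\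 &\quad+2i\theta_3|k|\big(c_1c_3e^{at}+c_2c_4e^{-at}-c_1c_3e^{\bar a t}-c_2c_4e^{-\bar a t}\big),\\ z_3(t)&=2\theta_3|k|\big(-2(c_1c_2a+c_3c_4\bar a)t+c_1c_2(e^{at}-e^{-at})+c_3c_4(e^{\bar a t}-e^{-\bar a t})\big)\\ &\quad-2\theta_1\theta_2\big(c_1c_3e^{2|k|t}+c_2c_4e^{-2|k|t}-c_1c_3-c_2c_4\big)\\ &\quad-2i\theta_2|k|\big(c_1c_3e^{at}+c_2c_4e^{-at}-c_1c_3e^{\bar a t}-c_2c_4e^{-\bar a t}\big). \end{align*} The constants of integration $c_1,\dots,c_4$ are related to the initial velocity $(\dot x_1^0,\dot x_2^0,\dot x_3^0,\dot x_4^0)$, $\dot x_j^0=\dot x_j(0)$, by \begin{align*} c_1&=\frac{k(\dot x_1^0+i\dot x_2^0)+|k|(\dot x_4^0+i\dot x_3^0)}{4iak|k|},& c_2&=\frac{-\bar k(\dot x_1^0-i\dot x_2^0)+|k|(\dot x_4^0-i\dot x_3^0)}{4ia\bar k|k|},\\ c_3&=\frac{\bar k(\dot x_1^0-i\dot x_2^0)+|k|(\dot x_4^0-i\dot x_3^0)}{4i\bar a\bar k|k|},& c_4&=\frac{-k(\dot x_1^0+i\dot x_2^0)+|k|(\dot x_4^0+i\dot x_3^0)}{4i\bar a k|k|}, \end{align*} where $k=\theta_2+i\theta_3$ and $a=|k|+i\theta_1$ are first integrals of the Hamiltonian system ($\theta_1,\theta_2,\theta_3$ being constant along its solutions).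
   Context: On $\mathbb R^7$ (a Lie group whose identity is the origin) consider the vector fields $$X_1=\partial_{x_1}+\tfrac12(x_2\partial_{z_1}-x_4\partial_{z_2}-x_3\partial_{z_3}),\quad X_2=\partial_{x_2}+\tfrac12(-x_1\partial_{z_1}-x_3\partial_{z_2}+x_4\partial_{z_3}),$$ $$X_3=\partial_{x_3}+\tfrac12(x_4\partial_{z_1}+x_2\partial_{z_2}+x_1\partial_{z_3}),\quad X_4=\partial_{x_4}+\tfrac12(-x_3\partial_{z_1}+x_1\partial_{z_2}-x_2\partial_{z_3}).$$ The metric $Q$ on $S=\mathrm{span}\{X_1,\dots,X_4\}$ makes the $X_j$ orthogonal with $Q(X_1,X_1)=Q(X_2,X_2)=-1$, $Q(X_3,X_3)=Q(X_4,X_4)=1$. Let $(\xi_1,\dots,\xi_4,\theta_1,\theta_2,\theta_3)$ be the momenta dual to $(x_1,\dots,x_4,z_1,z_2,z_3)$. The Hamiltonian is $H=\tfrac12(-h_1^2-h_2^2+h_3^2+h_4^2)$, where $h_j=\langle X_j,(\xi,\theta)\rangle$ is the pairing of the vector $X_j(x,z)$ with the covector $\sum_j\xi_jdx_j+\sum_\beta\theta_\beta dz_\beta$. The Hamiltonian system is $\dot x=\partial H/\partial\xi$, $\dot z=\partial H/\partial\theta$, $\dot\xi=-\partial H/\partial x$, $\dot\theta=-\partial H/\partial z$. A normal extremal is the projection to $(x,z)$-space of a solution along which $H\neq0$. *)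

(* Defs.v *)
From Stdlib Require Import Reals.
From Coquelicot Require Import Coquelicot.

Open Scope R_scope.

(** Coordinates of R^7: [cx j1 .. cx j4] are x_1, .., x_4 and
    [cz b1 .. cz b3] are z_1, .., z_3.  The index type [hidx] also numbers the
    frame X_1, .., X_4. *)
Inductive hidx : Set := j1 | j2 | j3 | j4.
Inductive vidx : Set := b1 | b2 | b3.
Inductive coord : Set := cx (j : hidx) | cz (b : vidx).

Definition coord_eq_dec (c d : coord) : {c = d} + {c <> d}.
Proof. decide equality; decide equality. Defined.

Definition vec7 : Type := coord -> R.

Definition mk_vec7 (u1 u2 u3 u4 w1 w2 w3 : R) : vec7 := fun c =>
  match c with
  | cx j1 => u1 | cx j2 => u2 | cx j3 => u3 | cx j4 => u4
  | cz b1 => w1 | cz b2 => w2 | cz b3 => w3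
  end.

(** Pairing of a tangent vector with a covector [m], whose components are
    xi_j = [m (cx j)] and theta_b = [m (cz b)]. *)
Definition pairing (v m : vec7) : R :=
  v (cx j1) * m (cx j1) + v (cx j2) * m (cx j2)
  + v (cx j3) * m (cx j3) + v (cx j4) * m (cx j4)
  + v (cz b1) * m (cz b1) + v (cz b2) * m (cz b2) + v (cz b3) * m (cz b3).

Definition X (j : hidx) (q : vec7) : vec7 :=
  let x1 := q (cx j1) in let x2 := q (cx j2) in
  let x3 := q (cx j3) in let x4 := q (cx j4) in
  match j with
  | j1 => mk_vec7 1 0 0 0 (/ 2 * x2) (/ 2 * - x4) (/ 2 * - x3)
  | j2 => mk_vec7 0 1 0 0 (/ 2 * - x1) (/ 2 * - x3) (/ 2 * x4)
  | j3 => mk_vec7 0 0 1 0 (/ 2 * x4) (/ 2 * x2) (/ 2 * x1)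
  | j4 => mk_vec7 0 0 0 1 (/ 2 * - x3) (/ 2 * x1) (/ 2 * - x2)
  end.

(** The metric Q on S = span {X_1, .., X_4}, a horizontal vector
    sum_j u_j X_j being represented by its components u_j in the frame.  As
    X_j has no other x-component than d/dx_j, u_j is also the x_j-component
    of that vector. *)
Definition Q (u w : hidx -> R) : R :=
  - (u j1 * w j1) - u j2 * w j2 + u j3 * w j3 + u j4 * w j4.

Definition h (j : hidx) (q m : vec7) : R := pairing (X j q) m.

Definition H (q m : vec7) : R :=
  / 2 * (- (h j1 q m) ^ 2 - (h j2 q m) ^ 2 + (h j3 q m) ^ 2 + (h j4 q m) ^ 2).

Definition upd (p : vec7) (c : coord) (s : R) : vec7 :=
  fun d => if coord_eq_dec d c then s else p d.

Definition partial (F : vec7 -> R) (c : coord) (p : vec7) : R :=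
  Derive (fun s => F (upd p c s)) (p c).

(** Time ranges over an open interval, possibly unbounded. *)
Definition in_itv (lo hi : Rbar) (t : R) : Prop := Rbar_lt lo t /\ Rbar_lt t hi.

Definition hamiltonian_solution (lo hi : Rbar) (q m : R -> vec7) : Prop :=
  forall t : R, in_itv lo hi t -> forall c : coord,
    is_derive (fun s => q s c) t (partial (fun m' => H (q t) m') c (m t)) /\
    is_derive (fun s => m s c) t (- partial (fun q' => H q' (m t)) c (q t)).

Definition normal_lift (lo hi : Rbar) (q m : R -> vec7) : Prop :=
  hamiltonian_solution lo hi q m /\
  forall t : R, in_itv lo hi t -> H (q t) (m t) <> 0.

Definition theta_of (m : vec7) : vidx -> R := fun b => m (cz b).

Definition Cexp (w : C) : C := (exp (Re w) * cos (Im w), exp (Re w) * sin (Im w)).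

Open Scope C_scope.

Definition kc (theta : vidx -> R) : C := theta b2 + Ci * theta b3.

Definition ac (theta : vidx -> R) : C := Cmod (kc theta) + Ci * theta b1.

Definition cst1 (theta : vidx -> R) (v : hidx -> R) : C :=
  let k := kc theta in let a := ac theta in let K := RtoC (Cmod k) in
  (k * (v j1 + Ci * v j2) + K * (v j4 + Ci * v j3)) / (4 * Ci * a * k * K).

Definition cst2 (theta : vidx -> R) (v : hidx -> R) : C :=
  let k := kc theta in let a := ac theta in let K := RtoC (Cmod k) in
  (- Cconj k * (v j1 - Ci * v j2) + K * (v j4 - Ci * v j3))
  / (4 * Ci * a * Cconj k * K).

Definition cst3 (theta : vidx -> R) (v : hidx -> R) : C :=
  let k := kc theta in let a := ac theta in let K := RtoC (Cmod k) in
  (Cconj k * (v j1 - Ci * v j2) + K * (v j4 - Ci * v j3))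
  / (4 * Ci * Cconj a * Cconj k * K).

Definition cst4 (theta : vidx -> R) (v : hidx -> R) : C :=
  let k := kc theta in let a := ac theta in let K := RtoC (Cmod k) in
  (- k * (v j1 + Ci * v j2) + K * (v j4 + Ci * v j3))
  / (4 * Ci * Cconj a * k * K).

(** The right-hand sides of the parametric equations, as complex numbers;
    [v] is the initial velocity of (x_1, .., x_4). *)
Definition param_curve (theta : vidx -> R) (v : hidx -> R) (t : R) (c : coord) : C :=
  let k := kc theta in let kb := Cconj k in let K := RtoC (Cmod k) in
  let a := ac theta in let ab := Cconj a in
  let th1 := RtoC (theta b1) in
  let th2 := RtoC (theta b2) in
  let th3 := RtoC (theta b3) in
  let C1 := cst1 theta v in let C2 := cst2 theta v in
  let C3 := cst3 theta v in let C4 := cst4 theta v in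
  let ep := Cexp (a * t) in let em := Cexp (- a * t) in
  let fp := Cexp (ab * t) in let fm := Cexp (- ab * t) in
  match c with
  | cx j1 =>
      Ci * K * (C1 * ep + C2 * em + C3 * fp + C4 * fm)
      - Ci * K * (C1 + C2 + C3 + C4)
  | cx j2 =>
      K * (C1 * ep - C2 * em - C3 * fp + C4 * fm) - K * (C1 - C2 - C3 + C4)
  | cx j3 =>
      C1 * k * ep + C2 * kb * em - C3 * kb * fp - C4 * k * fm
      - (C1 * k + C2 * kb - C3 * kb - C4 * k)
  | cx j4 =>
      Ci * (C1 * k * ep - C2 * kb * em + C3 * kb * fp - C4 * k * fm)
      - Ci * (C1 * k - C2 * kb + C3 * kb - C4 * k)
  | cz b1 =>
      2 * Ci * (K * K)
      * (- 2 * (C1 * C2 * a - C3 * C4 * ab) * t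
         + C1 * C2 * (ep - em) - C3 * C4 * (fp - fm))
  | cz b2 =>
      2 * th2 * K
      * (- 2 * (C1 * C2 * a + C3 * C4 * ab) * t
         + C1 * C2 * (ep - em) + C3 * C4 * (fp - fm))
      + 2 * th1 * th3
        * (C1 * C3 * Cexp (2 * K * t) + C2 * C4 * Cexp (- 2 * K * t)
           - C1 * C3 - C2 * C4)
      + 2 * Ci * th3 * K
        * (C1 * C3 * ep + C2 * C4 * em - C1 * C3 * fp - C2 * C4 * fm)
  | cz b3 =>
      2 * th3 * K
      * (- 2 * (C1 * C2 * a + C3 * C4 * ab) * t
         + C1 * C2 * (ep - em) + C3 * C4 * (fp - fm))
      - 2 * th1 * th2
        * (C1 * C3 * Cexp (2 * K * t) + C2 * C4 * Cexp (- 2 * K * t)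
           - C1 * C3 - C2 * C4)
      - 2 * Ci * th2 * K
        * (C1 * C3 * ep + C2 * C4 * em - C1 * C3 * fp - C2 * C4 * fm)
  end.

Close Scope C_scope.

(* Main.v *)
(** Along a solution theta is constant and the velocity u of x satisfies the
    linear equation u' = A u, where A is built from theta.  The numbers
    c_1, .., c_4, seen as linear functions of u, are eigenvectors of this
    equation with eigenvalues a, -a, conj a, -conj a, and u is recovered from
    them.  So c_i(u(t)) is c_i(u(0)) times an exponential, and (x, z) is fixed
    by its derivative, which depends only on u and x, and by its value at 0.
    Conversely, differentiating the parametric equations yields u (which is
    real since the curve is), and the momentum is read off from u and x; H is
    half the quantity Q(u, u), which the linear equation preserves. *)

Require Import Defs.
From Stdlib Require Import Reals Lra FunctionalExtensionality.
From Coquelicot Require Import Coquelicot.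

Open Scope R_scope.

(** * Calculus on open intervals, for real and for complex functions of a real variable *)

Lemma in_itv_between (lo hi : Rbar) (s t r : R) :
  in_itv lo hi s -> in_itv lo hi t -> s <= r <= t -> in_itv lo hi r.
Proof.
  intros [Hs _] [_ Ht] [Hsr Hrt]; split.
  - apply Rbar_lt_le_trans with s; assumption.
  - apply Rbar_le_lt_trans with t; assumption.
Qed.

Lemma in_itv_locally (lo hi : Rbar) (t : R) :
  in_itv lo hi t -> locally t (in_itv lo hi).
Proof.
  intros [Hl Hh]; apply filter_and.
  - apply (open_Rbar_gt lo t Hl).
  - apply (open_Rbar_lt hi t Hh).
Qed.

Lemma is_derive_zero_itv (lo hi : Rbar) (f : R -> R) :
  (forall t, in_itv lo hi t -> is_derive f t 0) ->
  forall s t, in_itv lo hi s -> in_itv lo hi t -> f t = f s.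
Proof.
  intros Hf.
  assert (Hlt : forall s t, in_itv lo hi s -> in_itv lo hi t -> s < t -> f s = f t).
  { intros s t Hs Ht Hst; apply eq_is_derive; [|exact Hst].
    intros r Hr; apply Hf, (in_itv_between lo hi s t); assumption. }
  intros s t Hs Ht; destruct (Rtotal_order s t) as [Hst | [-> | Hst]].
  - symmetry; apply Hlt; assumption.
  - reflexivity.
  - apply Hlt; assumption.
Qed.

(** Differentiation is componentwise, so that real derivatives of the coordinates of a curve and
    complex derivatives of the formulas pass into each other by projection. *)
Definition cderive (f : R -> C) (t : R) (l : C) : Prop :=
  is_derive (fun s => Re (f s)) t (Re l) /\ is_derive (fun s => Im (f s)) t (Im l).

Open Scope C_scope.

Lemma cderive_eq (f : R -> C) (t : R) (l l' : C) :
  cderive f t l -> l = l' -> cderive f t l'.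
Proof. intros Hf <-; exact Hf. Qed.

Lemma cderive_ext_itv (lo hi : Rbar) (f g : R -> C) (t : R) (l : C) :
  (forall s, in_itv lo hi s -> f s = g s) -> in_itv lo hi t ->
  cderive f t l -> cderive g t l.
Proof.
  intros Hfg Ht [Hr Hi]; split;
    (eapply is_derive_ext_loc; [|eassumption]);
    (eapply filter_imp; [|exact (in_itv_locally _ _ _ Ht)]);
    intros s Hs; simpl; now rewrite (Hfg s Hs).
Qed.

Lemma cderive_RtoC (f : R -> R) (t l : R) :
  is_derive f t l -> cderive (fun s => RtoC (f s)) t (RtoC l).
Proof. intros Hf; split; [exact Hf | exact (is_derive_const 0%R t)]. Qed.

(** The imaginary part of [g] vanishes near [t], hence so does its derivative. This is how the
    velocity of a parametric curve is seen to be real without computing with conjugates. *)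
Lemma cderive_real_itv (lo hi : Rbar) (f : R -> R) (g : R -> C) (t : R) (l : C) :
  (forall s, in_itv lo hi s -> RtoC (f s) = g s) -> in_itv lo hi t ->
  cderive g t l -> is_derive f t (Re l) /\ l = RtoC (Re l).
Proof.
  intros Hfg Ht Hg.
  assert (Hf : cderive (fun s => RtoC (f s)) t l).
  { apply (cderive_ext_itv lo hi g); [|exact Ht|exact Hg].
    intros s Hs; symmetry; apply Hfg, Hs. }
  destruct Hf as [Hr Hi]; split; [exact Hr|].
  apply injective_projections; [reflexivity|].
  apply is_derive_unique in Hi.
  change (Im l = 0%R); rewrite <- Hi; exact (Derive_const 0%R t).
Qed.

Lemma cderive_const (c : C) (t : R) : cderive (fun _ => c) t 0.
Proof. split; exact (is_derive_const _ t). Qed.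

Lemma cderive_id (t : R) : cderive (fun s => RtoC s) t 1.
Proof. apply cderive_RtoC; exact (is_derive_id t). Qed.

Lemma cderive_plus (f g : R -> C) (t : R) (l m : C) :
  cderive f t l -> cderive g t m -> cderive (fun s => f s + g s) t (l + m).
Proof.
  intros [Hf Hf'] [Hg Hg']; split.
  - exact (is_derive_plus _ _ _ _ _ Hf Hg).
  - exact (is_derive_plus _ _ _ _ _ Hf' Hg').
Qed.

Lemma cderive_opp (f : R -> C) (t : R) (l : C) :
  cderive f t l -> cderive (fun s => - f s) t (- l).
Proof.
  intros [Hf Hf']; split.
  - exact (is_derive_opp _ _ _ Hf).
  - exact (is_derive_opp _ _ _ Hf').
Qed.

Lemma cderive_minus (f g : R -> C) (t : R) (l m : C) :
  cderive f t l -> cderive g t m -> cderive (fun s => f s - g s) t (l - m).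
Proof. intros Hf Hg; apply cderive_plus, cderive_opp; assumption. Qed.

Lemma cderive_mult (f g : R -> C) (t : R) (l m : C) :
  cderive f t l -> cderive g t m ->
  cderive (fun s => f s * g s) t (l * g t + f t * m).
Proof.
  intros [Hf Hf'] [Hg Hg'].
  assert (Hm : forall u v du dv, is_derive u t du -> is_derive v t dv ->
            is_derive (fun s => u s * v s)%R t (du * v t + u t * dv)%R).
  { intros u v du dv Hu Hv; exact (is_derive_mult u v t du dv Hu Hv Rmult_comm). }
  split.
  - replace (Re (l * g t + f t * m)) with
      ((Re l * Re (g t) + Re (f t) * Re m) - (Im l * Im (g t) + Im (f t) * Im m))%R
      by (unfold Re, Im; simpl; ring).
    exact (is_derive_minus _ _ _ _ _ (Hm _ _ _ _ Hf Hg) (Hm _ _ _ _ Hf' Hg')).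
  - replace (Im (l * g t + f t * m)) with
      ((Re l * Im (g t) + Re (f t) * Im m) + (Im l * Re (g t) + Im (f t) * Re m))%R
      by (unfold Re, Im; simpl; ring).
    exact (is_derive_plus _ _ _ _ _ (Hm _ _ _ _ Hf Hg') (Hm _ _ _ _ Hf' Hg)).
Qed.

Lemma cderive_Cexp (w : C) (t : R) :
  cderive (fun s => Cexp (w * s)) t (w * Cexp (w * t)).
Proof.
  destruct w as [x y]; unfold Cexp, Re, Im; split; simpl; auto_derive; trivial; unfold Rminus; ring.
Qed.

Ltac cderive_auto :=
  lazymatch goal with
  | |- cderive (fun _ => ?c) _ _ => apply (cderive_const c)
  | |- cderive (fun s => Cexp (?w * RtoC s)) _ _ => apply (cderive_Cexp w)
  | |- cderive (fun s => RtoC s) _ _ => apply cderive_id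
  | |- cderive (fun s => @?f s + @?g s) _ _ => apply (cderive_plus f g); cderive_auto
  | |- cderive (fun s => @?f s - @?g s) _ _ => apply (cderive_minus f g); cderive_auto
  | |- cderive (fun s => - @?f s) _ _ => apply (cderive_opp f); cderive_auto
  | |- cderive (fun s => @?f s * @?g s) _ _ => apply (cderive_mult f g); cderive_auto
  | Hf : cderive ?f _ _ |- cderive ?f _ _ => exact Hf
  end.

Lemma Cexp_0 (w : C) : Cexp (w * 0) = 1.
Proof.
  replace (w * 0) with (RtoC 0) by ring.
  unfold Cexp; simpl; rewrite exp_0, cos_0, sin_0.
  apply injective_projections; simpl; ring.
Qed.

Lemma Cexp_plus (w w' : C) : Cexp (w + w') = Cexp w * Cexp w'.
Proof.
  unfold Cexp, Re, Im; simpl; rewrite exp_plus, cos_plus, sin_plus.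
  apply injective_projections; simpl; ring.
Qed.

Lemma Cexp_mult_opp (w : C) (t : R) : Cexp (w * t) * Cexp (- w * t) = 1.
Proof.
  rewrite <- Cexp_plus.
  replace (w * t + - w * t) with (w * 0) by ring; apply Cexp_0.
Qed.

Lemma cderive_unique_itv (lo hi : Rbar) (f g : R -> C) (l : R -> C) :
  (forall t, in_itv lo hi t -> cderive f t (l t)) ->
  (forall t, in_itv lo hi t -> cderive g t (l t)) ->
  forall s t, in_itv lo hi s -> in_itv lo hi t -> f s = g s -> f t = g t.
Proof.
  intros Hf Hg s t Hs Ht Hfg; apply Ceq_minus.
  replace (RtoC 0) with (f s - g s) by (rewrite Hfg; ring).
  assert (Hd : forall r, in_itv lo hi r -> cderive (fun r => f r - g r) r 0).
  { intros r Hr; apply cderive_eq with (l r - l r); [|ring].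
    apply cderive_minus; [apply Hf | apply Hg]; exact Hr. }
  apply injective_projections.
  - apply (is_derive_zero_itv lo hi (fun r => Re (f r - g r))); try assumption.
    intros r Hr; apply (Hd r Hr).
  - apply (is_derive_zero_itv lo hi (fun r => Im (f r - g r))); try assumption.
    intros r Hr; apply (Hd r Hr).
Qed.

(** Multiplying by the integrating factor [Cexp (- w * t)] gives a function with zero derivative. *)
Lemma cderive_linear_itv (lo hi : Rbar) (f : R -> C) (w : C) :
  (forall t, in_itv lo hi t -> cderive f t (w * f t)) ->
  forall t, in_itv lo hi 0 -> in_itv lo hi t -> f t = f 0%R * Cexp (w * t).
Proof.
  intros Hf t H0 Ht.
  assert (Hc : f t * Cexp (- w * t) = f 0%R).
  { apply (cderive_unique_itv lo hi (fun s => f s * Cexp (- w * s)) (fun _ => f 0%R)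
             (fun _ => 0)) with 0%R; try assumption.
    - intros s Hs; specialize (Hf s Hs).
      eapply cderive_eq; [cderive_auto | ring].
    - intros s _; apply cderive_const.
    - rewrite Cexp_0; ring. }
  rewrite <- Hc; ring [(Cexp_mult_opp w t)].
Qed.

(** * The linear velocity equation, and the algebra of k and a *)

Definition eps (j : hidx) : R :=
  match j with j1 | j2 => -1 | j3 | j4 => 1 end.

(** Poisson brackets of [h_1, .., h_4], contracted with [w]: along the flow of
    [H] the velocity [u] of [x] satisfies [u' = eps * bracket theta u]. *)
Definition bracket (theta : vidx -> R) (w : hidx -> C) (j : hidx) : C :=
  match j with
  | j1 => theta b1 * w j2 - theta b2 * w j4 - theta b3 * w j3
  | j2 => - theta b1 * w j1 - theta b2 * w j3 + theta b3 * w j4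
  | j3 => theta b1 * w j4 + theta b2 * w j2 + theta b3 * w j1
  | j4 => - theta b1 * w j3 + theta b2 * w j1 - theta b3 * w j2
  end.

(** Coordinates of the horizontal vector sum_j u_j X_j at [p]. Complex entries are allowed so that
    it applies to [param_curve], whose values are not known to be real beforehand. *)
Definition lift (p : coord -> C) (u : hidx -> C) (c : coord) : C :=
  let x1 := p (cx j1) in let x2 := p (cx j2) in
  let x3 := p (cx j3) in let x4 := p (cx j4) in
  match c with
  | cx j => u j
  | cz b1 => (/ 2)%R * (u j1 * x2 - u j2 * x1 + u j3 * x4 - u j4 * x3)
  | cz b2 => (/ 2)%R * (- u j1 * x4 - u j2 * x3 + u j3 * x2 + u j4 * x1)
  | cz b3 => (/ 2)%R * (- u j1 * x3 + u j2 * x4 + u j3 * x1 - u j4 * x2)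
  end.

Lemma Cmult_2_inv (z w : C) : 2 * z = w -> z = (/ 2)%R * w.
Proof.
  intros <-; rewrite Cmult_assoc, <- RtoC_mult, Rinv_l by lra; ring.
Qed.

(** Together with [Cmod_kc_sqr] and the two conjugation lemmas, this turns the later identities into
    polynomial ones in theta, i and |k|, which [ring] decides modulo i^2 = -1 and |k|^2 = theta_2^2
    + theta_3^2. *)
Lemma Ci_sqr : Ci * Ci = - (1).
Proof. apply injective_projections; simpl; ring. Qed.

Lemma Cmod_kc_sqr (theta : vidx -> R) :
  RtoC (Cmod (kc theta)) * Cmod (kc theta) = theta b2 * theta b2 + theta b3 * theta b3.
Proof.
  rewrite <- RtoC_mult.
  replace (Cmod (kc theta) * Cmod (kc theta))%R
    with (theta b2 * theta b2 + theta b3 * theta b3)%R;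
    [now rewrite RtoC_plus, !RtoC_mult|].
  unfold Cmod, kc; rewrite sqrt_sqrt; [simpl; ring|].
  apply Rplus_le_le_0_compat; apply pow2_ge_0.
Qed.

Lemma Cconj_kc (theta : vidx -> R) : Cconj (kc theta) = theta b2 - Ci * theta b3.
Proof. apply injective_projections; simpl; ring. Qed.

Lemma Cconj_ac (theta : vidx -> R) :
  Cconj (ac theta) = Cmod (kc theta) - Ci * theta b1.
Proof. apply injective_projections; simpl; ring. Qed.

Lemma Cconj_neq_0 (w : C) : w <> 0 -> Cconj w <> 0.
Proof.
  intros Hw E; apply Hw; rewrite <- (Cconj_conj w), E.
  apply injective_projections; simpl; ring.
Qed.

Lemma Cmod_kc_neq_0 (theta : vidx -> R) : kc theta <> 0 -> RtoC (Cmod (kc theta)) <> 0.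
Proof. intros Hk E; apply Hk, Cmod_eq_0, RtoC_inj, E. Qed.

(** The real part of a is |k|. *)
Lemma ac_neq_0 (theta : vidx -> R) : kc theta <> 0 -> ac theta <> 0.
Proof.
  intros Hk E; apply (Cmod_kc_neq_0 _ Hk).
  apply (f_equal Re) in E; unfold ac in E; simpl in E.
  f_equal; rewrite <- E; ring.
Qed.

(** * Eigenmodes of the velocity equation and the derivative of the parametric curve *)

Section modes.

Context (theta : vidx -> R).
Let k := kc theta.
Let kb := Cconj k.
Let K := RtoC (Cmod k).
Let a := ac theta.
Let ab := Cconj a.

(** The x-part of the parametric equations, up to its additive constants, when
    [E1, .., E4] are [c_1 e^(a t), .., c_4 e^(- conj a t)]. *)
Definition mode_position (E1 E2 E3 E4 : C) (j : hidx) : C :=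
  match j with
  | j1 => Ci * K * (E1 + E2 + E3 + E4)
  | j2 => K * (E1 - E2 - E3 + E4)
  | j3 => E1 * k + E2 * kb - E3 * kb - E4 * k
  | j4 => Ci * (E1 * k - E2 * kb + E3 * kb - E4 * k)
  end.

Definition mode_velocity (E1 E2 E3 E4 : C) : hidx -> C :=
  mode_position (a * E1) (- a * E2) (ab * E3) (- ab * E4).

(** The formulas for c_1, .., c_4 invert the superposition of modes. The identity is rational in i,
    k, |k|, a and the conjugates of k and a, treated as independent nonzero quantities, so [field]
    proves it. *)
Lemma mode_velocity_cst (v : hidx -> R) (j : hidx) :
  kc theta <> 0 ->
  mode_velocity (cst1 theta v) (cst2 theta v) (cst3 theta v) (cst4 theta v) j = v j.
Proof.
  intros Hk.
  pose proof (Cmod_kc_neq_0 _ Hk) as HK.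
  pose proof (ac_neq_0 _ Hk) as Ha.
  pose proof (Cconj_neq_0 _ Hk) as Hkb.
  pose proof (Cconj_neq_0 _ Ha) as Hab.
  pose proof Ci_nz as Hi.
  assert (H4 : RtoC 4 <> 0) by (intros E; apply RtoC_inj in E; lra).
  unfold mode_velocity, mode_position, cst1, cst2, cst3, cst4.
  subst k kb K a ab.
  destruct j; field; repeat split; assumption.
Qed.

(** As linear forms in u, the c_i are left eigenvectors of the matrix of the velocity equation,
    which therefore decouples into four scalar equations. *)
Lemma cst_eigenmodes (u : R -> hidx -> R) (t : R) :
  (forall j, cderive (fun s => u s j) t (eps j * bracket theta (fun i => u t i) j)) ->
  cderive (fun s => cst1 theta (u s)) t (a * cst1 theta (u t)) /\
  cderive (fun s => cst2 theta (u s)) t (- a * cst2 theta (u t)) /\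
  cderive (fun s => cst3 theta (u s)) t (ab * cst3 theta (u t)) /\
  cderive (fun s => cst4 theta (u s)) t (- ab * cst4 theta (u t)).
Proof.
  intros Hu.
  pose proof (Hu j1) as H1; pose proof (Hu j2) as H2.
  pose proof (Hu j3) as H3; pose proof (Hu j4) as H4.
  pose proof Ci_sqr as Hi; pose proof (Cmod_kc_sqr theta) as HK.
  unfold cst1, cst2, cst3, cst4, Cdiv; cbv zeta.
  subst k kb K a ab.
  split; [|split; [|split]];
    (eapply cderive_eq; [cderive_auto|]).
  (* The inverse of the denominator is a constant factor common to both sides; as an opaque [D] it
     leaves a polynomial identity. *)
  all: match goal with |- context [/ ?d] => generalize (/ d); intros D end;
    rewrite ?Cconj_ac, ?Cconj_kc; unfold ac;
    remember (RtoC (Cmod (kc theta))) as K eqn:EK;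
    unfold kc, eps, bracket; ring [Hi HK].
Qed.

(** Dual to [cst_eigenmodes]: the four columns of [mode_velocity] are right eigenvectors for a, -a,
    conj a and -conj a. *)
Lemma mode_velocity_bracket (E1 E2 E3 E4 : C) (j : hidx) :
  eps j * bracket theta (mode_velocity E1 E2 E3 E4) j =
  mode_velocity (a * E1) (- a * E2) (ab * E3) (- ab * E4) j.
Proof.
  pose proof Ci_sqr as Hi; pose proof (Cmod_kc_sqr theta) as HK.
  unfold mode_velocity, mode_position, bracket, eps.
  subst k kb K a ab; rewrite Cconj_ac, Cconj_kc; unfold ac.
  remember (RtoC (Cmod (kc theta))) as K eqn:EK; unfold kc.
  destruct j; ring [Hi HK].
Qed.

Context (v : hidx -> R).

Definition param_velocity (t : R) : hidx -> C :=
  mode_velocity (cst1 theta v * Cexp (a * t)) (cst2 theta v * Cexp (- a * t))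
    (cst3 theta v * Cexp (ab * t)) (cst4 theta v * Cexp (- ab * t)).

Lemma param_velocity_0 (j : hidx) : kc theta <> 0 -> param_velocity 0 j = v j.
Proof.
  intros Hk; unfold param_velocity; rewrite !Cexp_0, !Cmult_1_r.
  apply mode_velocity_cst, Hk.
Qed.

Lemma cderive_param_velocity (t : R) (j : hidx) :
  cderive (fun s => param_velocity s j) t (eps j * bracket theta (param_velocity t) j).
Proof.
  unfold param_velocity at 2; rewrite mode_velocity_bracket.
  unfold param_velocity, mode_velocity, mode_position.
  destruct j; (eapply cderive_eq; [cderive_auto|ring]).
Qed.

Lemma param_curve_0 (c : coord) : param_curve theta v 0 c = 0.
Proof.
  unfold param_curve; cbv zeta; rewrite !Cexp_0.
  destruct c as [[]|[]]; ring.
Qed.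

(** Since a + conj a = 2|k|, every exponential in z_2 and z_3 is a monomial in the four mode
    exponentials. *)
Lemma Cexp_2_K (t : R) : Cexp (2 * K * t) = Cexp (a * t) * Cexp (ab * t).
Proof.
  rewrite <- Cexp_plus; f_equal; subst a ab; rewrite Cconj_ac; unfold ac.
  subst K k; ring.
Qed.

Lemma Cexp_opp_2_K (t : R) : Cexp (- 2 * K * t) = Cexp (- a * t) * Cexp (- ab * t).
Proof.
  rewrite <- Cexp_plus; f_equal; subst a ab; rewrite Cconj_ac; unfold ac.
  subst K k; ring.
Qed.

(** The parametric curve is horizontal, with frame components [param_velocity]. This holds for
    arbitrary constants c_i, which are therefore generalized. In the z-coordinates, products of
    opposite exponentials equal 1 and account for the terms linear in t. *)
Lemma cderive_param_curve (t : R) (c : coord) :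
  cderive (fun s => param_curve theta v s c) t
    (lift (param_curve theta v t) (param_velocity t) c).
Proof.
  pose proof (Cexp_mult_opp a t) as Hp; pose proof (Cexp_mult_opp ab t) as Hm.
  pose proof (Cexp_2_K t) as Hs; pose proof (Cexp_opp_2_K t) as Hd.
  pose proof Ci_sqr as Hi; pose proof (Cmod_kc_sqr theta) as HK.
  unfold param_curve, lift, param_velocity, mode_velocity, mode_position.
  fold k; fold K; fold kb; fold a; fold ab.
  cbv zeta.
  generalize (cst1 theta v) (cst2 theta v) (cst3 theta v) (cst4 theta v).
  intros C1 C2 C3 C4.
  destruct c as [[]|[]]; cbv beta iota;
    (eapply cderive_eq; [cderive_auto|]);
    rewrite ?Hs, ?Hd; clear Hs Hd;
    set (P := Cexp (a * t)) in *; set (M := Cexp (- a * t)) in *;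
    set (F := Cexp (ab * t)) in *; set (G := Cexp (- ab * t)) in *;
    clearbody P M F G;
    (* The x-coordinates are immediate; for the z-coordinates the factor 1/2 of [lift] is cleared
       first. *)
    [ring | ring | ring | ring | | | ]; apply Cmult_2_inv;
    subst kb ab a K k; rewrite ?Cconj_ac, ?Cconj_kc; unfold ac;
    remember (RtoC (Cmod (kc theta))) as L eqn:EL; unfold kc.
  all: ring [Hi HK Hp Hm].
Qed.

End modes.

(** * The Hamiltonian and its partial derivatives in terms of u_j = dH/dh_j *)

Definition control (p m : vec7) (j : hidx) : R := (eps j * h j p m)%R.

(** The coefficients of the frame are half its structure constants: h_j is xi_j plus half of
    [bracket] applied to x. *)
Lemma RtoC_control (p m : vec7) (j : hidx) :
  RtoC (control p m j) =
  eps j * (m (cx j) + (/ 2)%R * bracket (theta_of m) (fun i => p (cx i)) j).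
Proof.
  unfold control, h, pairing, X, eps, bracket, theta_of.
  destruct j; simpl; apply injective_projections; simpl; ring.
Qed.

Lemma H_control (p m : vec7) : H p m = (/ 2 * Q (control p m) (control p m))%R.
Proof. unfold H, Q, control, eps; ring. Qed.

Lemma partial_H_momentum (p m : vec7) (c : coord) :
  RtoC (partial (fun m' => H p m') c m) =
  lift (fun d => p d) (fun j => control p m j) c.
Proof.
  (* The right side is a complex expression with a real value; passing to its real part allows a
     real derivative computation, and reality is checked separately. *)
  transitivity (RtoC (Re (lift (fun d => p d) (fun j => control p m j) c))).
  - f_equal; apply is_derive_unique.
    destruct c as [[]|[]]; unfold H, h, pairing, upd, X; simpl;
      (auto_derive; [trivial|]); unfold control, h, pairing, X, eps; simpl; field.
  - destruct c as [[]|[]]; apply injective_projections; simpl; ring.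
Qed.

(** Differentiating h_i in x_j gives half the (i, j) entry of the matrix of [bracket]; its
    skew-symmetry absorbs the minus sign. No h_i depends on z. *)
Lemma partial_H_position (p m : vec7) (c : coord) :
  RtoC (- partial (fun p' => H p' m) c p) =
  match c with
  | cx j => (/ 2)%R * bracket (theta_of m) (fun i => control p m i) j
  | cz _ => 0
  end.
Proof.
  set (w := match c with cx j => _ | cz _ => _ end).
  transitivity (RtoC (Re w)).
  - f_equal; rewrite <- (Ropp_involutive (Re w)); f_equal; apply is_derive_unique.
    subst w.
    destruct c as [[]|[]]; unfold H, h, pairing, upd, X; simpl;
      (auto_derive; [trivial|]);
      unfold control, h, pairing, X, eps, theta_of; simpl; field.
  - subst w; destruct c as [[]|[]]; apply injective_projections; simpl; ring.
Qed.

(** Only the x-coordinates of the base point enter [lift], so z can be integrated once x and u are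
    known. *)
Lemma lift_ext (p p' : coord -> C) (u u' : hidx -> C) (c : coord) :
  (forall j, p (cx j) = p' (cx j)) -> (forall j, u j = u' j) ->
  lift p u c = lift p' u' c.
Proof. intros Hp Hu; unfold lift; rewrite !Hp, !Hu; destruct c; [apply Hu|reflexivity]. Qed.

(** * Constancy of theta and the velocity equation along a Hamiltonian solution *)

Section solution.

Context (lo hi : Rbar) (q m : R -> vec7).
Context (Hsol : hamiltonian_solution lo hi q m).

Lemma theta_constant (s t : R) (b : vidx) :
  in_itv lo hi s -> in_itv lo hi t -> theta_of (m t) b = theta_of (m s) b.
Proof.
  apply (is_derive_zero_itv lo hi (fun r => m r (cz b))).
  intros r Hr; destruct (Hsol r Hr (cz b)) as [_ Hm].
  pose proof (partial_H_position (q r) (m r) (cz b)) as E.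
  apply RtoC_inj in E; rewrite E in Hm; exact Hm.
Qed.

Lemma cderive_solution_position (t : R) (c : coord) :
  in_itv lo hi t ->
  cderive (fun s => q s c) t
    (lift (fun d => q t d) (fun j => control (q t) (m t) j) c).
Proof.
  intros Ht; rewrite <- partial_H_momentum.
  apply cderive_RtoC, (Hsol t Ht c).
Qed.

Lemma cderive_solution_control (t : R) (j : hidx) :
  in_itv lo hi t ->
  cderive (fun s => control (q s) (m s) j) t
    (eps j * bracket (theta_of (m t)) (fun i => control (q t) (m t) i) j).
Proof.
  intros Ht.
  assert (Hq := fun i => cderive_solution_position t (cx i) Ht).
  assert (Hm : forall c, cderive (fun s => m s c) t
    match c with
    | cx j => (/ 2)%R * bracket (theta_of (m t)) (fun i => control (q t) (m t) i) j
    | cz _ => 0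
    end).
  { intros c; rewrite <- partial_H_position; apply cderive_RtoC, (Hsol t Ht c). }
  pose proof (Hq j1); pose proof (Hq j2); pose proof (Hq j3); pose proof (Hq j4).
  pose proof (Hm (cz b1)); pose proof (Hm (cz b2)); pose proof (Hm (cz b3)).
  pose proof (Hm (cx j)); clear Hq Hm.
  apply (cderive_ext_itv lo hi (fun s => eps j * (m s (cx j)
           + (/ 2)%R * bracket (theta_of (m s)) (fun i => q s (cx i)) j)));
    [intros s _; symmetry; apply RtoC_control | exact Ht |].
  unfold theta_of in *.
  (* One half comes from the derivative of xi, the other from that of the x-terms in h_j. Keeping
     their sum explicit lets [ring] treat 1/2 as an atom. *)
  assert (Hh : RtoC (/ 2) + (/ 2)%R = 1) by (rewrite <- RtoC_plus; f_equal; lra).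
  destruct j; simpl bracket in *; (eapply cderive_eq; [cderive_auto|]);
    unfold lift, eps;
    match goal with |- _ = ?r => transitivity ((RtoC (/ 2) + (/ 2)%R) * r) end;
    (ring || (rewrite Hh; ring)).
Qed.

End solution.

(** The signs [eps] square to 1, so the derivative of Q(u, u) is twice the Euclidean product of u
    with [bracket theta u], which vanishes by skew-symmetry. *)
Lemma Q_invariant (lo hi : Rbar) (theta : vidx -> R) (u : R -> hidx -> R) :
  (forall t j, in_itv lo hi t ->
     cderive (fun s => u s j) t (eps j * bracket theta (fun i => u t i) j)) ->
  forall s t, in_itv lo hi s -> in_itv lo hi t -> Q (u t) (u t) = Q (u s) (u s).
Proof.
  intros Hu s t Hs Ht; apply (is_derive_zero_itv lo hi (fun r => Q (u r) (u r)));
    try assumption.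
  intros r Hr.
  pose proof (Hu r j1 Hr); pose proof (Hu r j2 Hr).
  pose proof (Hu r j3 Hr); pose proof (Hu r j4 Hr).
  replace 0%R with (Re 0) by reflexivity.
  eapply (cderive_real_itv lo hi (fun r => Q (u r) (u r))
    (fun r => - (u r j1 * u r j1) - u r j2 * u r j2 + u r j3 * u r j3 + u r j4 * u r j4));
    [|exact Hr|].
  - intros z _; unfold Q; rewrite !RtoC_plus, RtoC_minus, RtoC_opp, !RtoC_mult; ring.
  - eapply cderive_eq; [cderive_auto | unfold eps, bracket; ring].
Qed.

(** * Passage between Hamiltonian solutions and parametric curves *)

Lemma solution_is_param (lo hi : Rbar) (theta : vidx -> R) (v : hidx -> R)
    (q m : R -> vec7) :
  in_itv lo hi 0 -> kc theta <> 0 -> hamiltonian_solution lo hi q m ->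
  (forall c, q 0%R c = 0%R) -> (forall b, theta_of (m 0%R) b = theta b) ->
  (forall j, control (q 0%R) (m 0%R) j = v j) ->
  forall t, in_itv lo hi t -> forall c, RtoC (q t c) = param_curve theta v t c.
Proof.
  intros H0 Hk Hsol Hq0 Hth Hv.
  set (u := fun t => control (q t) (m t)).
  assert (Htheta : forall t, in_itv lo hi t -> theta_of (m t) = theta).
  { intros t Ht; apply functional_extensionality; intros b; rewrite <- Hth.
    apply (theta_constant lo hi q m Hsol); assumption. }
  assert (Hu0 : u 0%R = v) by (apply functional_extensionality, Hv).
  assert (Hu : forall t, in_itv lo hi t -> forall j, RtoC (u t j) = param_velocity theta v t j).
  { intros t Ht j; rewrite <- (mode_velocity_cst theta (u t) j Hk).
    assert (Hmodes := fun s Hs => cst_eigenmodes theta u s (fun j =>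
      (* The velocity equation at time s involves [theta_of (m s)]; this transports it to the fixed
         [theta]. *)
      eq_ind _ (fun th => cderive (fun r => u r j) s (eps j * bracket th (fun i => u s i) j))
        (cderive_solution_control lo hi q m Hsol s j Hs) _ (Htheta s Hs))).
    unfold param_velocity; rewrite <- Hu0; f_equal.
    - apply (cderive_linear_itv lo hi (fun s => cst1 theta (u s))); trivial; apply Hmodes.
    - apply (cderive_linear_itv lo hi (fun s => cst2 theta (u s))); trivial; apply Hmodes.
    - apply (cderive_linear_itv lo hi (fun s => cst3 theta (u s))); trivial; apply Hmodes.
    - apply (cderive_linear_itv lo hi (fun s => cst4 theta (u s))); trivial; apply Hmodes. }
  (* A coordinate agrees everywhere once its derivatives agree, both curves starting at 0. This is
     applied to the x-coordinates first, whose derivative is u alone, and then to all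
     coordinates. *)
  assert (Hstep : forall c,
    (forall s, in_itv lo hi s -> lift (fun d => q s d) (fun j => u s j) c =
       lift (param_curve theta v s) (param_velocity theta v s) c) ->
    forall t, in_itv lo hi t -> RtoC (q t c) = param_curve theta v t c).
  { intros c Hc t Ht.
    apply (cderive_unique_itv lo hi (fun s => RtoC (q s c)) (fun s => param_curve theta v s c)
      (fun s => lift (param_curve theta v s) (param_velocity theta v s) c)) with 0%R;
      try assumption.
    - intros s Hs; rewrite <- Hc by exact Hs.
      apply (cderive_solution_position lo hi q m Hsol), Hs.
    - intros s _; apply cderive_param_curve.
    - rewrite Hq0, param_curve_0; reflexivity. }
  assert (Hx : forall j t, in_itv lo hi t -> RtoC (q t (cx j)) = param_curve theta v t (cx j)).
  { intros j; apply Hstep; intros s Hs; apply (Hu s Hs). }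
  intros t Ht c; apply Hstep; [|exact Ht].
  intros s Hs; apply lift_ext; intros j; [apply Hx | apply Hu]; exact Hs.
Qed.

Lemma param_is_solution (lo hi : Rbar) (theta : vidx -> R) (v : hidx -> R)
    (q : R -> vec7) :
  in_itv lo hi 0 -> kc theta <> 0 ->
  (forall t, in_itv lo hi t -> forall c, RtoC (q t c) = param_curve theta v t c) ->
  exists m : R -> vec7, hamiltonian_solution lo hi q m /\
    (forall b, theta_of (m 0%R) b = theta b) /\
    (forall t, in_itv lo hi t -> Q (control (q t) (m t)) (control (q t) (m t)) = Q v v) /\
    (forall j, control (q 0%R) (m 0%R) j = v j).
Proof.
  intros H0 Hk Hq.
  set (u := fun t j => Re (param_velocity theta v t j)).
  (* Reality of the velocity is inherited from the real curve [q]. *)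
  assert (Hu : forall t, in_itv lo hi t -> forall j, param_velocity theta v t j = RtoC (u t j)).
  { intros t Ht j.
    apply (cderive_real_itv lo hi (fun s => q s (cx j)) (fun s => param_curve theta v s (cx j)) t);
      [intros s Hs; apply Hq, Hs | exact Ht |].
    apply (cderive_param_curve theta v t (cx j)). }
  assert (Hu0 : forall j, u 0%R j = v j).
  { intros j; apply RtoC_inj; rewrite <- Hu, param_velocity_0; trivial. }
  assert (Hdu : forall t j, in_itv lo hi t ->
            cderive (fun s => u s j) t (eps j * bracket theta (fun i => u t i) j)).
  { intros t j Ht.
    apply (cderive_ext_itv lo hi (fun s => param_velocity theta v s j));
      [intros s Hs; apply Hu, Hs | exact Ht |].
    replace (fun i => RtoC (u t i)) with (param_velocity theta v t)
      by (apply functional_extensionality, Hu, Ht).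
    apply cderive_param_velocity. }
  (* The momentum solves [control (q t) (m t) = u t] for xi, as in [RtoC_control]; each [eps j] is
     its own inverse. *)
  set (m := fun t c => match c with
    | cx j => (eps j * u t j - / 2 * Re (bracket theta (fun i => q t (cx i)) j))%R
    | cz b => theta b
    end).
  assert (Hm : forall t, control (q t) (m t) = u t).
  { intros t; apply functional_extensionality; intros j; apply RtoC_inj.
    rewrite RtoC_control; unfold m, theta_of.
    destruct j; unfold eps; apply injective_projections; simpl; field. }
  exists m; split; [|split; [|split]].
  - intros t Ht c.
    assert (Hdq : forall d, cderive (fun s => q s d) t
              (lift (fun d => q t d) (fun j => u t j) d)).
    { intros d.
      apply (cderive_ext_itv lo hi (fun s => param_curve theta v s d));
        [intros s Hs; symmetry; apply Hq, Hs | exact Ht |].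
      rewrite (lift_ext _ (param_curve theta v t) _ (param_velocity theta v t)).
      - apply cderive_param_curve.
      - intros j; apply Hq, Ht.
      - intros j; symmetry; apply Hu, Ht. }
    split.
    + specialize (Hdq c); rewrite <- Hm, <- partial_H_momentum in Hdq; apply Hdq.
    + assert (Hdm : cderive (fun s => m s c) t (- partial (fun q' => H q' (m t)) c (q t))%R).
      { rewrite partial_H_position, Hm.
        change (theta_of (m t)) with theta.
        destruct c as [j|b]; [|exact (cderive_const (theta b) t)].
        (* The first term contributes [bracket theta u] and the second removes half of it, leaving
           the half required by Hamilton's equation for xi. *)
        apply (cderive_ext_itv lo hi (fun s => eps j * u s j
                 - (/ 2)%R * bracket theta (fun i => q s (cx i)) j)); [|exact Ht|].
        - intros s _; unfold m, bracket, eps.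
          destruct j; apply injective_projections; simpl; ring.
        - pose proof (Hdq (cx j1)); pose proof (Hdq (cx j2)).
          pose proof (Hdq (cx j3)); pose proof (Hdq (cx j4)).
          pose proof (Hdu t j Ht).
          destruct j; unfold bracket in *; (eapply cderive_eq; [cderive_auto|]);
            unfold lift, eps; apply injective_projections; simpl; field. }
      apply Hdm.
  - reflexivity.
  - intros t Ht; rewrite Hm.
    rewrite (Q_invariant lo hi theta u Hdu 0 t H0 Ht); unfold Q; rewrite !Hu0; reflexivity.
  - intros j; rewrite Hm; apply Hu0.
Qed.

(* First integrals and the equivalence for normal extremals *)
Close Scope C_scope.

Theorem theorem6p1 :
  (forall (lo hi : Rbar) (q m : R -> vec7),
     hamiltonian_solution lo hi q m ->
     forall s t : R, in_itv lo hi s -> in_itv lo hi t ->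
       (forall b : vidx, theta_of (m t) b = theta_of (m s) b) /\
       kc (theta_of (m t)) = kc (theta_of (m s)) /\
       ac (theta_of (m t)) = ac (theta_of (m s)))
  /\
  (forall (lo hi : Rbar) (theta : vidx -> R) (v : hidx -> R) (q : R -> vec7),
     in_itv lo hi 0 ->
     kc theta <> RtoC 0 ->
     ((exists m : R -> vec7,
         normal_lift lo hi q m /\
         (forall c : coord, q 0 c = 0) /\
         (forall b : vidx, theta_of (m 0) b = theta b) /\
         (forall j : hidx, is_derive (fun s => q s (cx j)) 0 (v j)))
      <->
      (Q v v <> 0 /\
       forall t : R, in_itv lo hi t ->
         forall c : coord, RtoC (q t c) = param_curve theta v t c))).
Proof.
  split.
  - intros lo hi q m Hsol s t Hs Ht.
    assert (Hth : theta_of (m t) = theta_of (m s)).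
    { apply functional_extensionality; intros b.
      apply (theta_constant lo hi q m Hsol); assumption. }
    rewrite Hth; auto.
  - intros lo hi theta v q H0 Hk; split.
    + intros [m [[Hsol HH] [Hq0 [Hth Hv]]]].
      (* By Hamilton's equations the initial x-velocity is [control] at time 0, so uniqueness of
         derivatives identifies it with [v]. *)
      assert (Hc : forall j, control (q 0) (m 0) j = v j).
      { intros j.
        destruct (cderive_solution_position lo hi q m Hsol 0 (cx j) H0) as [Hd _].
        rewrite <- (is_derive_unique _ _ _ (Hv j)); symmetry.
        apply is_derive_unique, Hd. }
      split.
      * intros HQ; apply (HH 0 H0).
        rewrite H_control; unfold Q; rewrite !Hc; fold (Q v v).
        rewrite HQ; ring.
      * apply (solution_is_param lo hi theta v q m); assumption.
    + intros [HQ Hq].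
      destruct (param_is_solution lo hi theta v q H0 Hk Hq) as [m [Hsol [Hth [HQc Hc]]]].
      exists m; split; [split; [exact Hsol|]|split; [|split; [exact Hth|]]].
      (* Along the whole lift H equals the constant Q(v, v)/2. *)
      * intros t Ht; rewrite H_control, HQc by exact Ht.
        intros E; apply HQ; lra.
      * intros c; apply RtoC_inj; rewrite Hq by exact H0; apply param_curve_0.
      * intros j; rewrite <- Hc.
        apply (cderive_solution_position lo hi q m Hsol 0 (cx j) H0).
Qed.
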